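(* Let $(X,\Sigma,\mu)$ be a measure space with non-trivial, $\sigma$-finite, diffuse measure. Let $1\le a_1<b_1\le\infty$ and $1\le a_2<b_2\le\infty$ with $1/b_1+1/b_2<1$, let $\psi_1,\psi_2$ be admissible weights on $(a_1,b_1)$ and $(a_2,b_2)$ respectively, and let $f\in G(\psi_1;a_1,b_1)$ and $g\in G(\psi_2;a_2,b_2)$. Put $$A_1=\max\left(1,\frac{a_1a_2}{a_1+a_2}\right),\qquad B_1=\frac{b_1b_2}{b_1+b_2},$$ and for $r\in(A_1,B_1)$ $$\psi_3(r)=\inf\left\{\psi_1(pr)\,\psi_2(qr):\ p,q>1,\ \frac1p+\frac1q=1\right\}.$$ Then $$\|f\,g\|_{G(\psi_3;A_1,B_1)}\le\|f\|_{G(\psi_1;a_1,b_1)}\,\|g\|_{G(\psi_2;a_2,b_2)}.$$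
   Context: A measure $\mu$ is diffuse if for every $A\in\Sigma$ with $\mu(A)\in(0,\infty)$ there exists a measurable $B\subset A$ with $\mu(B)=\mu(A)/2$. For $1\le a<b\le\infty$, an admissible weight on $(a,b)$ is a continuous, positive, log-convex function $\psi:(a,b)\to(0,\infty)$ such that the limits $\psi(a+0)$ and $\psi(b-0)$ exist (possibly $+\infty$), $\max(\psi(a+0),\psi(b-0))=\infty$ and $\min(\psi(a+0),\psi(b-0))>0$. For a positive function $\psi$ on $(a,b)$, the space $G(\psi;a,b)$ consists of all measurable $h:X\to\mathbb{R}$ with finite norm $\|h\|_{G(\psi;a,b)}=\sup_{p\in(a,b)}|h|_p/\psi(p)$, where $|h|_p=\left(\int_X|h|^p\,d\mu\right)^{1/p}$. The same formula defines the norm with weight $\psi_3$. The infimum defining $\psi_3(r)$ is over those $p,q$ for which the expressions are defined, i.e. $pr\in(a_1,b_1)$ and $qr\in(a_2,b_2)$. If some $b_i=\infty$, $B_1$ is understood through $1/B_1=1/b_1+1/b_2$ with $1/\infty=0$ (and $B_1=\infty$ if both are infinite). *)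

(* Defs.v *)
From HB Require Import structures.
From mathcomp Require Import all_boot all_order all_algebra.
From mathcomp Require Import all_classical all_reals all_analysis.

Set Implicit Arguments.
Unset Strict Implicit.
Unset Printing Implicit Defensive.

Import Order.TTheory GRing.Theory Num.Theory.
Import numFieldNormedType.Exports.

Local Open Scope classical_set_scope.
Local Open Scope ring_scope.

Definition diffuse d (T : measurableType d) (R : realType)
    (mu : {measure set T -> \bar R}) : Prop :=
  forall A : set T, measurable A -> (0 < mu A < +oo)%E ->
    exists B : set T, [/\ measurable B, B `<=` A & mu B = (mu A / 2%:E)%E].

(* The right endpoint may be +oo. *)
Definition open_itv (R : realType) (a : R) (b : \bar R) : set R :=
  [set x | a < x /\ (x%:E < b)%E].

(* [b] is either finite or +oo; at +oo the limit b-0 is the limit x -> +oo. *)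
Definition left_nbhs (R : realType) (b : \bar R) : set_system R :=
  if b is r%:E then r^'- else pinfty_nbhs R.

Definition admissible_weight (R : realType) (a : R) (b : \bar R)
    (psi : R -> R) : Prop :=
  [/\ {within open_itv a b, continuous psi},
      forall x, open_itv a b x -> 0 < psi x,
      convex_function (open_itv a b) (fun x => ln (psi x)) &
      exists la lb : \bar R,
        [/\ (psi x)%:E @[x --> a^'+] --> la,
            (psi x)%:E @[x --> left_nbhs b] --> lb,
            Order.max la lb = +oo%E &
            (0 < Order.min la lb)%E]].

Definition Gnorm d (T : measurableType d) (R : realType)
    (mu : {measure set T -> \bar R}) (psi : R -> R) (a : R) (b : \bar R)
    (h : T -> R) : \bar R :=
  ereal_sup
    [set ('N[mu]_p%:E[EFin \o h] / (psi p)%:E)%E | p in open_itv a b].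

Definition Gspace d (T : measurableType d) (R : realType)
    (mu : {measure set T -> \bar R}) (psi : R -> R) (a : R) (b : \bar R) :
    set (T -> R) :=
  [set h | measurable_fun [set: T] h /\ (Gnorm mu psi a b h < +oo)%E].

Definition lower_end (R : realType) (a1 a2 : R) : R :=
  Num.max 1 (a1 * a2 / (a1 + a2)).

(* With an infinite endpoint, 1/B = 1/b1 + 1/b2 where 1/oo = 0 and 1/0 = oo. *)
Definition upper_end (R : realType) (b1 b2 : \bar R) : \bar R :=
  match b1, b2 with
  | x%:E, y%:E => (x * y / (x + y))%:E
  | _, _ => ((b1^-1 + b2^-1)^-1)%E
  end.

(* For r strictly between the endpoints lower_end a1 a2 and upper_end b1 b2
   (and psi1, psi2 positive) the set is nonempty and bounded below by 0, so the
   real-valued [inf] is the actual infimum. *)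
Definition product_weight (R : realType) (a1 : R) (b1 : \bar R) (a2 : R)
    (b2 : \bar R) (psi1 psi2 : R -> R) (r : R) : R :=
  inf [set y | exists p q : R,
    [/\ 1 < p /\ 1 < q, 1 / p + 1 / q = 1,
        open_itv a1 b1 (p * r), open_itv a2 b2 (q * r) &
        y = psi1 (p * r) * psi2 (q * r)]].

(* Main.v *)
Require Import Defs.
From HB Require Import structures.
From mathcomp Require Import all_boot all_order all_algebra.
From mathcomp Require Import all_classical all_reals all_analysis.
From mathcomp Require Import ring lra.

Set Implicit Arguments.
Unset Strict Implicit.
Unset Printing Implicit Defensive.

Import Order.TTheory GRing.Theory Num.Theory.
Import numFieldNormedType.Exports.
Local Open Scope classical_set_scope.
Local Open Scope ring_scope.

(** Write [P = p r] and [Q = q r], so that [1/p + 1/q = 1] becomes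
    [1/P + 1/Q = 1/r].  Hoelder's inequality with these exponents, followed by
    the definition of the two norms as suprema, gives
    [|f g|_r <= |f|_P |g|_Q <= ||f|| ||g|| psi1(P) psi2(Q)]
    for every admissible pair [(P, Q)], and the infimum over all pairs yields
    [|f g|_r <= ||f|| ||g|| psi3(r)] ([Gspace_mul_le]).

    Taking the infimum is legitimate only if there is at least one admissible
    pair: the infimum of the empty set of reals is the junk value 0.  This is
    what the range of [r] guarantees ([conjugate_exponents_exist]).  In terms of
    reciprocals one must split [1/r] as [t + u] with [1/b1 < t < 1/a1] and
    [1/b2 < u < 1/a2], which is possible exactly when
    [1/b1 + 1/b2 < 1/r < 1/a1 + 1/a2]. *)

Section Hoelder.
Context d (T : measurableType d) (R : realType).
Variable mu : {measure set T -> \bar R}.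
Local Open Scope ereal_scope.

Lemma Lnorm_powR (h : T -> R) (p r : R) : (r != 0)%R ->
  'N[mu]_p%:E[EFin \o (fun x => `|h x| `^ r)%R]
  = 'N[mu]_(p * r)%:E[EFin \o h] `^ r.
Proof.
move=> r0; rewrite unlock /= -poweRrM invfM mulfVK//.
congr (_ `^ _); apply: eq_integral => x _ /=.
by rewrite ger0_norm ?powR_ge0// -powRrM mulrC.
Qed.

(** Since [r/p + r/q = 1], this is the usual inequality, bounding the [L^1] norm
    of a product, applied to [|f|^r] and [|g|^r] with exponents [p / r] and
    [q / r]. *)
Lemma Lnorm_mul_le (f g : T -> R) (p q r : R) :
  measurable_fun [set: T] f -> measurable_fun [set: T] g ->
  (0 < p)%R -> (0 < q)%R -> (0 < r)%R -> (p^-1 + q^-1 = r^-1)%R ->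
  'N[mu]_r%:E[EFin \o (fun x => f x * g x)%R]
  <= 'N[mu]_p%:E[EFin \o f] * 'N[mu]_q%:E[EFin \o g].
Proof.
move=> mf mg p0 q0 r0 pqr; have rN0 : (r != 0)%R by rewrite gt_eqF.
have mpow (h : T -> R) : measurable_fun [set: T] h ->
    measurable_fun [set: T] (fun x => `|h x| `^ r)%R.
  move=> mh; apply: (@measurableT_comp _ _ _ _ _ _ (@powR R ^~ r)) => //.
  exact: measurableT_comp.
have := @hoelder _ _ _ mu _ _ (p / r) (q / r) (mpow _ mf) (mpow _ mg).
rewrite !divr_gt0// !invf_div -mulrDr pqr divff// => /(_ isT isT erefl).
rewrite !Lnorm_powR// !divfK// -poweRM ?Lnorm_ge0//.
have -> : ((fun x => `|f x| `^ r) \* (fun x => `|g x| `^ r))%R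
    = (fun x => `|f x * g x| `^ r)%R.
  by apply/funext => x /=; rewrite normrM powRM.
rewrite Lnorm_powR// mul1r => /(@gt0_ler_poweR _ r^-1).
rewrite invr_ge0 ltW// -!poweRrM divff// !poweRe1 ?mule_ge0 ?Lnorm_ge0//.
by apply => //; rewrite in_itv/= leey andbT ?poweR_ge0.
Qed.

End Hoelder.

Section Exponents.
Variable R : realType.
Implicit Types (a r x y : R) (b : \bar R).

Lemma inve_pos b : (0 < b)%E ->
  exists2 c : R, 0 <= c & (b^-1 = c%:E)%E.
Proof.
case: b => [x||//]; last by exists 0.
rewrite lte_fin => x0; exists x^-1; first by rewrite invr_ge0 ltW.
by rewrite inver gt_eqF.
Qed.

Lemma lte_EFin_inv r b : 0 < r -> (0 <= b)%E ->
  (r%:E < b)%E = (b^-1 < (r^-1)%:E)%E.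
Proof.
move=> r0 b0; rewrite -(@lte_pV2 _ b r%:E) ?inE ?lee_fin ?(ltW r0)//.
by rewrite inver gt_eqF.
Qed.

(** Reciprocals absorb the infinite endpoints: with [1 / +oo = 0] the
    case distinction in [upper_end] disappears. *)
Lemma upper_endE b1 b2 : (0 < b1)%E -> (0 < b2)%E ->
  upper_end b1 b2 = ((b1^-1 + b2^-1)^-1)%E.
Proof.
case: b1 b2 => [x||//] [y||//] //=; rewrite !lte_fin => x0 y0.
rewrite !inver !gt_eqF//= -EFinD inver gt_eqF ?addr_gt0 ?invr_gt0//.
congr EFin; field.
by rewrite !gt_eqF ?addr_gt0.
Qed.

(** In terms of [t = 1/x] the two memberships read [1/b1 < t < 1/a1] and
    [1/b2 < 1/r - t < 1/a2], so [t] must lie strictly between the larger of two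
    lower bounds and the smaller of two upper bounds; of the four inequalities
    that this takes, two are [a1 < b1] and [a2 < b2], and the other two are the
    bounds on [r]. *)
Lemma conjugate_exponents_exist a1 a2 b1 b2 r :
  0 < a1 -> 0 < a2 -> (a1%:E < b1)%E -> (a2%:E < b2)%E ->
  open_itv (lower_end a1 a2) (upper_end b1 b2) r ->
  exists x y, [/\ open_itv a1 b1 x, open_itv a2 b2 y & x^-1 + y^-1 = r^-1].
Proof.
move=> a10 a20 ab1 ab2 [].
have b10 : (0 < b1)%E by apply: lt_trans ab1; rewrite lte_fin.
have b20 : (0 < b2)%E by apply: lt_trans ab2; rewrite lte_fin.
rewrite /lower_end gt_max => /andP[r1 ar].
have r0 : 0 < r by rewrite (lt_trans _ r1).
have [c1 c10 bc1] := inve_pos b10; have [c2 c20 bc2] := inve_pos b20.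
have ac1 : c1 < a1^-1 by move: ab1; rewrite lte_EFin_inv ?ltW// bc1 lte_fin.
have ac2 : c2 < a2^-1 by move: ab2; rewrite lte_EFin_inv ?ltW// bc2 lte_fin.
have {}ar : r^-1 < a1^-1 + a2^-1.
  have -> : a1^-1 + a2^-1 = (a1 * a2 / (a1 + a2))^-1.
    by field; rewrite !gt_eqF ?addr_gt0.
  by rewrite ltf_pV2 // posrE ?divr_gt0 ?mulr_gt0 ?addr_gt0.
rewrite upper_endE// bc1 bc2 -EFinD lte_EFin_inv ?inve_ge0 ?lee_fin ?addr_ge0//.
rewrite inveK lte_fin => cr.
pose l := Num.max c1 (r^-1 - a2^-1); pose h := Num.min a1^-1 (r^-1 - c2).
have lh : l < h by rewrite /l /h gt_max !lt_min; lra.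
have [t /andP[lt th]] : exists t, l < t < h by exists ((l + h) / 2); lra.
move: lt th; rewrite gt_max lt_min => /andP[ct rt] /andP[ta tr].
have t0 : 0 < t by lra.
have u0 : 0 < r^-1 - t by lra.
exists t^-1, (r^-1 - t)^-1; rewrite !invrK; split; last by ring.
- split; first by rewrite -(invrK a1) ltf_pV2 ?posrE// invr_gt0.
  by rewrite lte_EFin_inv ?invr_gt0 ?ltW// bc1 invrK lte_fin.
- split; first by rewrite -(invrK a2) ltf_pV2 ?posrE ?invr_gt0//; lra.
  by rewrite lte_EFin_inv ?invr_gt0 ?ltW// bc2 invrK lte_fin; lra.
Qed.

End Exponents.

Section Bounds.
Variable R : realType.
Implicit Types x K : \bar R.
Local Open Scope ereal_scope.

(** The case [s = 0] matters: there [x = 0], and [0 / 0 = 0 * +oo = 0]. *)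
Lemma lee_pdivr_ge0 x K (s : R) :
  0 <= x -> 0 <= K -> (0 <= s)%R -> x <= K * s%:E -> x / s%:E <= K.
Proof.
move=> x0 K0; rewrite le_eqVlt => /predU1P[<-|s0 xK].
  rewrite mule0 => x_le0; have -> : x = 0 by apply/eqP; rewrite eq_le x_le0.
  by rewrite mul0e.
by rewrite inver gt_eqF// lee_pdivrMr.
Qed.

Lemma le_mule_inf (S : set R) x K :
  S !=set0 -> 0 <= x -> 0 <= K -> K < +oo ->
  (forall s, S s -> x <= K * s%:E) -> x <= K * (inf S)%:E.
Proof.
move=> [s0 Ss0] x0 K0 Koo xKS; have := xKS _ Ss0.
move: x K x0 K0 Koo xKS => [x||] [k||]//; rewrite !lee_fin => x0 k0 _ xkS _.
move: k0; rewrite le_eqVlt => /predU1P[k0|k0].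
  by have := xkS _ Ss0; rewrite -k0 lee_fin !mul0r.
rewrite -ler_pdivrMl//; apply: lb_le_inf; first by exists s0.
by move=> s /xkS; rewrite -EFinM lee_fin ler_pdivrMl.
Qed.

End Bounds.

Section Gspaces.
Context d (T : measurableType d) (R : realType).
Variable mu : {measure set T -> \bar R}.
Implicit Types (psi : R -> R) (a p : R) (b : \bar R) (h : T -> R).
Local Open Scope ereal_scope.

Lemma Gnorm_ubound psi a b h p : open_itv a b p ->
  'N[mu]_p%:E[EFin \o h] / (psi p)%:E <= Gnorm mu psi a b h.
Proof. by move=> abp; apply: ereal_sup_ubound; exists p. Qed.

Lemma Lnorm_le_Gnorm psi a b h p : open_itv a b p -> (0 < psi p)%R ->
  'N[mu]_p%:E[EFin \o h] <= Gnorm mu psi a b h * (psi p)%:E.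
Proof.
move=> abp psi0; have := @Gnorm_ubound psi a b h p abp.
by rewrite inver gt_eqF// lee_pdivrMr.
Qed.

(** The supremum of the empty set is [-oo], so a point of the interval is
    needed. *)
Lemma Gnorm_ge0 psi a b h p : open_itv a b p -> (0 < psi p)%R ->
  0 <= Gnorm mu psi a b h.
Proof.
move=> abp psi0; apply: le_trans (@Gnorm_ubound psi a b h p abp).
by rewrite mule_ge0 ?Lnorm_ge0// inve_ge0 lee_fin ltW.
Qed.

Lemma product_weight_ge0 a1 b1 a2 b2 psi1 psi2 r :
  (forall x, open_itv a1 b1 x -> 0 < psi1 x)%R ->
  (forall x, open_itv a2 b2 x -> 0 < psi2 x)%R ->
  (0 <= product_weight a1 b1 a2 b2 psi1 psi2 r)%R.
Proof.
move=> psi1_gt0 psi2_gt0; rewrite /product_weight.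
set S := [set y | _]; have [->|/set0P S0] := eqVneq S set0; first by rewrite inf0.
apply: lb_le_inf => // _ [p [q [_ _ abp abq ->]]].
by rewrite mulr_ge0 ?ltW ?psi1_gt0 ?psi2_gt0.
Qed.

Lemma Gspace_mul_le a1 b1 a2 b2 psi1 psi2 (f g : T -> R) r :
  (0 < a1)%R -> (0 < a2)%R -> a1%:E < b1 -> a2%:E < b2 ->
  (forall x, open_itv a1 b1 x -> 0 < psi1 x)%R ->
  (forall x, open_itv a2 b2 x -> 0 < psi2 x)%R ->
  Gspace mu psi1 a1 b1 f -> Gspace mu psi2 a2 b2 g ->
  open_itv (lower_end a1 a2) (upper_end b1 b2) r ->
  'N[mu]_r%:E[EFin \o (fun x => f x * g x)%R] /
    (product_weight a1 b1 a2 b2 psi1 psi2 r)%:E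
  <= Gnorm mu psi1 a1 b1 f * Gnorm mu psi2 a2 b2 g.
Proof.
move=> a10 a20 ab1 ab2 psi1_gt0 psi2_gt0 [mf foo] [mg goo] rAB.
have r0 : (0 < r)%R.
  by case: rAB; rewrite /lower_end gt_max => /andP[/(lt_trans ltr01)].
have [x [y [abx aby xyr]]] := conjugate_exponents_exist a10 a20 ab1 ab2 rAB.
have x0 : (0 < x)%R by apply: lt_trans abx.1.
have y0 : (0 < y)%R by apply: lt_trans aby.1.
have f0 := @Gnorm_ge0 psi1 a1 b1 f x abx (psi1_gt0 _ abx).
have g0 := @Gnorm_ge0 psi2 a2 b2 g y aby (psi2_gt0 _ aby).
apply: lee_pdivr_ge0; rewrite ?Lnorm_ge0 ?mule_ge0 ?product_weight_ge0//.
apply: le_mule_inf; rewrite ?Lnorm_ge0 ?mule_ge0//.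
- (* [p = x / r > 1] because [1/x < 1/x + 1/y = 1/r], and likewise for [q]. *)
  exists (psi1 x * psi2 y)%R, (x / r)%R, (y / r)%R.
  rewrite !divfK ?gt_eqF// !div1r !invf_div; split=> //.
  + have y_inv0 : (0 < y^-1)%R by rewrite invr_gt0.
    have x_inv0 : (0 < x^-1)%R by rewrite invr_gt0.
    rewrite !ltr_pdivlMr// !mul1r; split.
      by rewrite -ltf_pV2 ?posrE//; lra.
    by rewrite -ltf_pV2 ?posrE//; lra.
  + by rewrite -mulrDr xyr divff// gt_eqF.
- by rewrite lte_mul_pinfty// fin_numE; move: f0 foo; case: Gnorm.
move=> _ [p [q [[p1 q1] pq abp abq ->]]].
have p0 : (0 < p)%R by apply: lt_trans p1.
have q0 : (0 < q)%R by apply: lt_trans q1.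
have prq : ((p * r)^-1 + (q * r)^-1 = r^-1)%R.
  by rewrite !invfM -mulrDl; move: pq; rewrite !div1r => ->; rewrite mul1r.
apply: (le_trans (Lnorm_mul_le mu mf mg _ _ r0 prq)); rewrite ?mulr_gt0//.
rewrite (EFinM (psi1 _)) muleACA; apply: lee_pmul; rewrite ?Lnorm_ge0//.
- by apply: Lnorm_le_Gnorm => //; exact: psi1_gt0.
- by apply: Lnorm_le_Gnorm => //; exact: psi2_gt0.
Qed.

End Gspaces.

Theorem theorem3 (R : realType) (d : measure_display) (T : measurableType d)
    (mu : {measure set T -> \bar R})
    (mu_nontrivial : mu [set: T] <> 0%E)
    (mu_sigma_finite : sigma_finite [set: T] mu)
    (mu_diffuse : diffuse mu)
    (a1 a2 : R) (b1 b2 : \bar R)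
    (a1_ge1 : 1 <= a1) (a1_lt_b1 : (a1%:E < b1)%E)
    (a2_ge1 : 1 <= a2) (a2_lt_b2 : (a2%:E < b2)%E)
    (b1b2 : (b1^-1 + b2^-1 < 1)%E)
    (psi1 psi2 : R -> R)
    (psi1_adm : admissible_weight a1 b1 psi1)
    (psi2_adm : admissible_weight a2 b2 psi2)
    (f g : T -> R)
    (fG : Gspace mu psi1 a1 b1 f) (gG : Gspace mu psi2 a2 b2 g) :
  (Gnorm mu (product_weight a1 b1 a2 b2 psi1 psi2)
     (lower_end a1 a2) (upper_end b1 b2) (fun x => f x * g x)%R
   <= Gnorm mu psi1 a1 b1 f * Gnorm mu psi2 a2 b2 g)%E.
Proof.
have a10 : 0 < a1 by apply: lt_le_trans a1_ge1.
have a20 : 0 < a2 by apply: lt_le_trans a2_ge1.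
have [_ psi1_gt0 _ _] := psi1_adm; have [_ psi2_gt0 _ _] := psi2_adm.
apply: ge_ereal_sup => _ [r rAB <-].
exact: Gspace_mul_le.
Qed.
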